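(* Let $s$ be a positive integer and for $1 \le i \le s$ let $m_i$ be a positive integer. Then $$\operatorname{aw}(\mathbb{Z}_{2^{m_1}} \times \mathbb{Z}_{2^{m_2}} \times \cdots \times \mathbb{Z}_{2^{m_s}}, 3) = 2^s + 1.$$
   Context: $\mathbb{Z}_m$ is the cyclic group $\{0,\dots,m-1\}$ under addition mod $m$. A $k$-term arithmetic progression ($k$-AP) in an abelian group $H$ is a sequence $a, a+d, \dots, a+(k-1)d$ with $a,d \in H$ (degenerate ones allowed). An $r$-coloring of $H$ is a function $c: H \to \{1,\dots,r\}$; it is exact if surjective. A $k$-AP is rainbow under $c$ if $c(a+id) \neq c(a+jd)$ for all $0 \le i < j \le k-1$. $\operatorname{aw}(H,k)$ is the smallest $r$ such that every exact $r$-coloring of $H$ contains a rainbow $k$-AP; if $H$ has no $k$-AP, $\operatorname{aw}(H,k)=|H|+1$. *)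

(* Defs.v *)
From HB Require Import structures.
From mathcomp Require Import all_boot all_order all_algebra.

Set Implicit Arguments.
Unset Strict Implicit.
Unset Printing Implicit Defensive.

Import GRing.Theory.
Local Open Scope ring_scope.

Definition zmod_prod (I : finType) (G : I -> finZmodType) : Type :=
  {dffun forall i : I, G i}.

Section ZmodProd.
Variables (I : finType) (G : I -> finZmodType).

HB.instance Definition _ := Finite.on (zmod_prod G).

Implicit Types x y z : zmod_prod G.

Definition zprod_zero : zmod_prod G := [ffun i : I => 0 : G i].
Definition zprod_opp x : zmod_prod G := [ffun i : I => - x i : G i].
Definition zprod_add x y : zmod_prod G := [ffun i : I => x i + y i : G i].

Fact zprod_addA : associative zprod_add.
Proof. by move=> x y z; apply/ffunP => i; rewrite !ffunE addrA. Qed.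

Fact zprod_addC : commutative zprod_add.
Proof. by move=> x y; apply/ffunP => i; rewrite !ffunE addrC. Qed.

Fact zprod_add0 : left_id zprod_zero zprod_add.
Proof. by move=> x; apply/ffunP => i; rewrite !ffunE add0r. Qed.

Fact zprod_addN : left_inverse zprod_zero zprod_opp zprod_add.
Proof. by move=> x; apply/ffunP => i; rewrite !ffunE addNr. Qed.

HB.instance Definition _ := GRing.isZmodule.Build (zmod_prod G)
  zprod_addA zprod_addC zprod_add0 zprod_addN.

End ZmodProd.

Section AntiVanDerWaerden.
Variable H : finZmodType.

Definition ap (a d : H) (i : nat) : H := a + d *+ i.

(* The r colors are indexed by 'I_r = {0, ..., r - 1}. *)
Definition exact_coloring r (c : {ffun H -> 'I_r}) : bool :=
  [forall x : 'I_r, exists h : H, c h == x].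

Definition rainbow_ap r (c : {ffun H -> 'I_r}) (k : nat) (a d : H) : bool :=
  [forall i : 'I_k, forall j : 'I_k,
     (i < j)%N ==> (c (ap a d i) != c (ap a d j))].

Definition has_rainbow_ap r (c : {ffun H -> 'I_r}) (k : nat) : bool :=
  [exists a : H, exists d : H, rainbow_ap c k a d].

(* A coloring uses at least one color: the conjunct 0 < r excludes r = 0, for *)
(* which there is no coloring of the (nonempty) group H at all.               *)
Definition forces_rainbow_ap (k r : nat) : bool :=
  (0 < r)%N &&
  [forall c : {ffun H -> 'I_r}, exact_coloring c ==> has_rainbow_ap c k].

Fact exact_coloring_card r (c : {ffun H -> 'I_r}) :
  exact_coloring c -> (r <= #|H|)%N.
Proof.
move=> /forallP ex; rewrite -{1}(card_ord r).
have sub : 'I_r \subset codom c.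
  by apply/subsetP => x _; have /existsP[h /eqP <-] := ex x; exact: codom_f.
by apply: leq_trans (subset_leq_card sub) (leq_image_card _ _).
Qed.

Fact forces_rainbow_ap_ex (k : nat) : exists r, forces_rainbow_ap k r.
Proof.
exists #|H|.+1; rewrite /forces_rainbow_ap /=.
by apply/forallP => c; apply/implyP => /exact_coloring_card; rewrite ltnn.
Qed.

Definition aw (k : nat) : nat := ex_minn (forces_rainbow_ap_ex k).

(* The convention aw(H, k) = |H| + 1 when H has no k-AP (with distinct terms) *)
(* needs no separate clause: there is no exact coloring with |H| + 1 colors.  *)
Lemma aw_no_ap (k : nat) :
  (forall a d : H, ~ injective (fun i : 'I_k => ap a d i)) ->
  aw k = #|H|.+1.
Proof.
move=> no_ap; rewrite /aw; case: ex_minnP => r /andP[r0 /forallP fr] rmin.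
apply/eqP; rewrite eqn_leq; apply/andP; split.
  apply: rmin; rewrite /forces_rainbow_ap /=.
  by apply/forallP => c; apply/implyP => /exact_coloring_card; rewrite ltnn.
rewrite ltnNge; apply/negP => rH.
case: r r0 fr rH {rmin} => // r _ fr rH.
pose c : {ffun H -> 'I_r.+1} := [ffun h => inord (enum_rank h)].
have exc : exact_coloring c.
  apply/forallP => x; apply/existsP.
  exists (enum_val (Ordinal (leq_trans (ltn_ord x) rH))).
  by rewrite ffunE enum_valK /= inord_val.
have /implyP/(_ exc)/existsP[a /existsP[d rb]] := fr c.
apply: (no_ap a d) => i j eqij; apply: val_inj => /=.
have rbP (i' j' : 'I_k) : (i' < j')%N -> ap a d i' <> ap a d j'.
  move: rb => /forallP/(_ i')/forallP/(_ j')/implyP rb /rb /negP ne e.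
  by apply: ne; rewrite e.
by case: (ltngtP i j) => // /rbP; rewrite eqij.
Qed.

End AntiVanDerWaerden.

(* Main.v *)
Require Import Defs.
From HB Require Import structures.
From mathcomp Require Import all_boot all_order all_algebra.
From mathcomp Require Import all_fingroup all_solvable zify.

(**
Write G multiplicatively, for an abelian 2-group, and let M be its subgroup of
squares, so that |G : M| is the number of elements with x^2 = 1.  Colouring by
the class modulo M gives no rainbow 3-AP, since the end terms of a 3-AP agree
modulo M.  Conversely, a rainbow-free colouring c uses at most |G : M| colours.
The tool is reflection: if c(z) does not occur on a set X stable under
x |-> z x^-1 z, then c is invariant under this reflection on X.

If G has an element with x^4 <> 1, take a subgroup K of index 2 containing all
x with x^4 = 1.  By induction K and its other coset each carry at most |G : M|
colours; if G carries more, there are p in K and q outside K whose colours are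
exclusive to their coset.  Composing reflections through p and q shows that c is
invariant under (p/q)^4 <> 1, and one passes to the quotient.

If G has exponent dividing 4, let R_x be the group of h such that c is invariant
on x M under translation by h^2.  Then x M has at most |G : R_x| colours, and
every point outside x R_x has one of them.  Pick x with R = R_x minimal.  Since
G is not the union of two proper subgroups, each coset y M in x R shares a
colour with x M (if R, R_y <> G), so with a = |G : R| and b = |R : M| there are
at most a + (b - 1)(a - 1) <= a b = |G : M| colours.
*)

Set Implicit Arguments.
Unset Strict Implicit.
Unset Printing Implicit Defensive.

Local Open Scope group_scope.

(* [x, z, refl z x] is the 3-AP with first terms x and z. *)
Definition refl (gT : finGroupType) (z x : gT) := z * x^-1 * z.

Definition rainbow_free (gT : finGroupType) (C : finType) (c : gT -> C)
    (A : {set gT}) :=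
  {in A &, forall x z,
     [\/ c x = c z, c z = c (refl z x) | c x = c (refl z x)]}.

(** * Reflections and the translations they compose to *)

Section Reflections.
Variables (gT : finGroupType) (C : finType).
Implicit Types (c : gT -> C) (A X Y : {set gT}) (G H K D : {group gT}).

Lemma rainbow_free_refl c A X x z :
  rainbow_free c A -> X \subset A -> z \in A -> c z \notin c @: X ->
  x \in X -> refl z x \in X -> c (refl z x) = c x.
Proof.
move=> rf sXA Az czX Xx Xr.
have [e|e|//] := rf x z (subsetP sXA x Xx) Az; case/negP: czX.
  by rewrite -e imset_f.
by rewrite e imset_f.
Qed.

(** Additively, [refl z] is x |-> 2z - x, so reflecting through q and then through 2p - q is
    translation by 4(p - q). *)
Lemma refl_reflE G p q x : abelian G -> p \in G -> q \in G -> x \in G ->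
  refl (refl p q) (refl q x) = (p * q^-1) ^+ 4 * x.
Proof.
move=> cGG Gp Gq Gx; have cG y z : y \in G -> z \in G -> y * z = z * y.
  by move=> Gy Gz; apply: (centsP cGG).
set e := p * q^-1; have Ge : e \in G by rewrite groupM ?groupV.
have ->: refl p q = e * e * q.
  by rewrite /refl -/e -mulgA /e -!mulgA mulVg mulg1.
have ->: refl (e * e * q) (refl q x) =
    (e * e * q) * (q^-1 * x * q^-1) * (q * (e * e)).
  have Gee : e * e \in G by rewrite groupM.
  by rewrite (cG q _ Gq Gee) /refl !invMg invgK !mulgA.
move: e Ge => e Ge.
rewrite !mulgA mulgK mulgKV -(mulgA _ e e) -(mulgA (e * e)) (cG x) ?groupM //.
by rewrite !expgS expg0 mulg1 !mulgA.
Qed.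

(** The colour of [p] occurs on [X], so [X] cannot be reflected through [p] itself. But [Y] can,
    which gives [refl p q] the colour of [q], missing from [X]; so [c] on [X] survives reflection
    through [q] and then through [refl p q]. *)
Lemma exclusive_invariant c G X Y p q x :
  abelian G -> rainbow_free c G -> X \subset G -> Y \subset G ->
  {in Y & X, forall y z, refl y z \in X} ->
  {in X & Y, forall y z, refl y z \in Y} ->
  p \in X -> q \in Y -> c p \notin c @: Y -> c q \notin c @: X -> x \in X ->
  c ((p * q^-1) ^+ 4 * x) = c x.
Proof.
move=> cGG rf sX sY YX XY Xp Yq cp cq Xx.
have [Gp Gq Gx] : [/\ p \in G, q \in G & x \in G].
  by split; [apply: (subsetP sX) | apply: (subsetP sY) | apply: (subsetP sX)].
have cq' : c (refl p q) = c q.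
  by apply: (rainbow_free_refl rf sY) => //; exact: XY.
rewrite -(refl_reflE cGG) //.
have Xr := YX _ _ Yq Xx.
rewrite (rainbow_free_refl rf sX) ?cq' //.
- by rewrite (rainbow_free_refl rf sX).
- by rewrite (subsetP sY) // XY.
- by apply: YX => //; apply: XY.
Qed.

Lemma index2_refl_mem G K x y : K \subset G -> #|G : K| = 2 ->
  y \in G :\: K -> x \in K -> refl y x \in K.
Proof.
move=> sKG iK yK Kx; apply/idPn => nK.
have [Gy nKy] : y \in G /\ y \notin K by case/setDP: yK.
have : refl y x \in K :* y.
  by rewrite (rcoset_index2 sKG iK yK) inE nK !groupM ?groupV ?(subsetP sKG x).
by rewrite mem_rcoset /refl mulgK groupMr ?groupV // (negPf nKy).
Qed.

Lemma index2_sqr_mem G K y : K \subset G -> #|G : K| = 2 ->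
  y \in G -> y ^+ 2 \in K.
Proof.
move=> sKG iK Gy; have [Ky|nKy] := boolP (y \in K); first exact: groupX.
have: refl y 1 \in K by rewrite (index2_refl_mem sKG iK) // inE nKy.
by rewrite /refl invg1 mulg1.
Qed.

End Reflections.

(** In a 2-group these are the kernel and the image of squaring. The kernel form compares the bound
    with that of a subgroup, the index form with that of a quotient. *)
Lemma card_Ohm1_index_Mho (gT : finGroupType) (G : {group gT}) :
  abelian G -> #|'Ohm_1(G)| = #|G : 'Mho^1(G)|.
Proof.
move=> cGG; rewrite -divgS ?Mho_sub // -(mul_card_Ohm_Mho_abelian 1 cGG).
by rewrite mulnK ?cardG_gt0.
Qed.

(** * The colouring induced on a quotient *)

Section Quotient.
Variables (gT : finGroupType) (C : finType) (c : gT -> C) (G D : {group gT}).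
Hypotheses (cGG : abelian G) (sDG : D \subset G).

Lemma abelian_sub_norm : G \subset 'N(D).
Proof. exact: sub_abelian_norm. Qed.

Hypothesis Dinv : {in D & G, forall d x, c (d * x) = c x}.

Lemma repr_coset_color x : x \in G -> c (repr (coset D x)) = c x.
Proof.
move=> Gx; have Nx := subsetP abelian_sub_norm x Gx.
have: repr (coset D x) \in D :* x by rewrite -val_coset // mem_repr_coset.
by case/rcosetP => d Dd ->; rewrite Dinv.
Qed.

Lemma rainbow_free_quotient :
  rainbow_free c G -> rainbow_free (fun x : coset_of D => c (repr x)) (G / D).
Proof.
move=> rf _ _ /morphimP[x Nx Gx ->] /morphimP[z Nz Gz ->].
set r := refl _ _; have {r}->: r = coset D (refl z x).
  by rewrite /r /refl !morphM ?morphV ?groupM ?groupV.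
rewrite !repr_coset_color ?groupM ?groupV //; exact: rf.
Qed.

Lemma imset_quotient_color :
  (fun x : coset_of D => c (repr x)) @: (G / D) = c @: G.
Proof.
apply/setP=> i; apply/imsetP/imsetP=> [[_ /morphimP[x Nx Gx ->] ->]|[x Gx ->]].
  by exists x; rewrite ?repr_coset_color.
by exists (coset D x); rewrite ?repr_coset_color // mem_quotient.
Qed.

Lemma card_Ohm1_quotient_leq : #|'Ohm_1(G / D)| <= #|'Ohm_1(G)|.
Proof.
rewrite !card_Ohm1_index_Mho ?quotient_abelian //.
rewrite -morphim_Mho ?abelian_sub_norm //.
apply: dvdn_leq; rewrite ?indexg_gt0 // index_morphim //.
exact: subset_trans (subsetIl _ _) abelian_sub_norm.
Qed.

End Quotient.

(** * Covering a group by two subgroups; a union bound *)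

Lemma exists_notin_subgroups (gT : finGroupType) (G H K : {group gT}) :
  ~~ (G \subset H) -> ~~ (G \subset K) ->
  exists x, [/\ x \in G, x \notin H & x \notin K].
Proof.
move=> /subsetPn[h Gh nHh] /subsetPn[k Gk nKk].
have [Kh|nKh] := boolP (h \in K); last by exists h.
have [Hk|nHk] := boolP (k \in H); last by exists k.
by exists (h * k); rewrite groupM // groupMr // groupMl.
Qed.

Lemma card_bigcup_leq (I T : finType) (P : {pred I}) (F : I -> {set T}) k :
  (forall i, i \in P -> #|F i| <= k) -> #|\bigcup_(i in P) F i| <= #|P| * k.
Proof.
move=> leF; rewrite -sum_nat_const.
elim/big_rec2: _ => [|i n U Pi le]; first by rewrite cards0.
by rewrite (leq_trans (leq_card_setU _ _).1) // leq_add ?leF.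
Qed.

(** * Groups of exponent dividing 4 *)

Section ExponentFour.
Variables (gT : finGroupType) (C : finType) (c : gT -> C) (G : {group gT}).
Hypotheses (cGG : abelian G) (pG : 2.-group G).

Let cG x y : x \in G -> y \in G -> x * y = y * x.
Proof. by move=> Gx Gy; apply: (centsP cGG). Qed.

Let sqM x y : x \in G -> y \in G -> (x * y) ^+ 2 = x ^+ 2 * y ^+ 2.
Proof. by move=> Gx Gy; apply/expgMn/cG. Qed.

(* In exponent 4, translating x M by h ^+ 2 is the same as reflecting it      *)
(* through any point of x h M: see [square_colors_mem].                       *)
Definition square_stab x :=
  [set h in G | [forall g in G, c (x * g ^+ 2 * h ^+ 2) == c (x * g ^+ 2)]].

Lemma square_stabP x h : reflect
  (h \in G /\ {in G, forall g, c (x * g ^+ 2 * h ^+ 2) = c (x * g ^+ 2)})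
  (h \in square_stab x).
Proof.
rewrite inE; apply: (iffP andP) => [[Gh /forall_inP i]|[Gh i]]; split=> //.
  by move=> g /i/eqP.
by apply/forall_inP=> g /i ->.
Qed.

Lemma square_stab_group_set x : group_set (square_stab x).
Proof.
apply/group_setP; split=> [|h k].
  by apply/square_stabP; split=> // g Gg; rewrite expg1n mulg1.
move=> /square_stabP[Gh ih] /square_stabP[Gk ik]; apply/square_stabP.
split=> [|g Gg]; first exact: groupM.
rewrite sqM // (mulgA (x * g ^+ 2)) -(mulgA x (g ^+ 2)) -sqM // ik ?groupM //.
by rewrite sqM // (mulgA x) ih.
Qed.
Canonical square_stab_group x := Group (square_stab_group_set x).

Lemma square_stab_sub x : square_stab x \subset G.
Proof. by apply/subsetP=> h /square_stabP[]. Qed.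

Definition square_colors x := [set c (x * g ^+ 2) | g in G].

(** The colour of x g^2 depends only on the coset of g modulo [square_stab x]. *)
Lemma square_colors_leq x : #|square_colors x| <= #|G : square_stab x|.
Proof.
apply: leq_trans (leq_imset_card (fun A : {set gT} => c (x * repr A ^+ 2)) _).
apply/subset_leq_card/subsetP=> _ /imsetP[g Gg ->].
apply/imsetP; exists (square_stab x :* g).
  by apply/rcosetsP; exists g.
have /rcosetP[h /square_stabP[Gh ih] ->] :=
  mem_repr_rcoset (square_stab_group x) g.
by rewrite (cG Gh Gg) sqM // (mulgA x (g ^+ 2)) ih.
Qed.

Hypothesis exp4 : {in G, forall x, x ^+ 4 = 1}.
Hypothesis rf : rainbow_free c G.

(** Some g gives x g^2 and x g^2 h^2 different colours. As g^4 = 1, these are the ends of a 3-AP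
    with middle term x h, which must repeat one of the two colours. *)
Lemma square_colors_mem x h : x \in G -> h \in G -> h \notin square_stab x ->
  c (x * h) \in square_colors x.
Proof.
move=> Gx Gh; rewrite inE Gh /= negb_forall => /existsP[g].
rewrite negb_imply => /andP[Gg ne].
have Gg2 : g ^+ 2 \in G by rewrite groupX.
have Gh2 : h ^+ 2 \in G by rewrite groupX.
have g2V : (g ^+ 2)^-1 = g ^+ 2.
  by apply/eqP; rewrite eq_invg_mul -expgD exp4.
have E : refl (x * h) (x * g ^+ 2) = x * g ^+ 2 * h ^+ 2.
  rewrite /refl invMg g2V; move: (g ^+ 2) Gg2 => u Gu.
  by rewrite !mulgA mulgKV -(mulgA x h) (cG Gh Gu) !mulgA.
have := rf (groupM Gx Gg2) (groupM Gx Gh); rewrite E; case=> e.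
- by rewrite -e imset_f.
- by rewrite e -mulgA -sqM ?imset_f ?groupM.
- by rewrite e eqxx in ne.
Qed.

Lemma exponent4_colors : #|c @: G| <= #|'Ohm_1(G)|.
Proof.
rewrite card_Ohm1_index_Mho //; set M := 'Mho^1(G).
have defM : M = [set x ^+ 2 | x in G] := MhoEabelian 1 pG cGG.
have sMR x : M \subset square_stab x.
  apply/subsetP=> y; rewrite defM => /imsetP[h Gh ->{y}].
  apply/square_stabP; split=> [|g Gg]; first exact: groupX.
  by rewrite -expgM exp4 // mulg1.
pose x0 := [arg min_(x < 1 | x \in G) #|square_stab x|].
have [Gx0 minR] : x0 \in G /\
    {in G, forall y, #|square_stab x0| <= #|square_stab y|}.
  by rewrite /x0; case: arg_minnP.
set R := square_stab x0 in minR; have sRG : R \subset G := square_stab_sub x0.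
pose a := #|G : R|; pose b := #|R : M|.
have ab : #|G : M| = (a * b)%N by rewrite -(Lagrange_index sRG (sMR x0)) mulnC.
have a0 : 0 < a := indexg_gt0 _ _.
have b0 : 0 < b := indexg_gt0 _ _.
have leA y : y \in G -> #|square_colors y| <= a.
  move=> Gy; apply: leq_trans (square_colors_leq y) _.
  rewrite /a -(divgS (square_stab_sub y)) -(divgS sRG).
  by rewrite leq_div2l ?minR // cardG_gt0.
(* The colours that the coset x0 B adds to those of x0 M. By [square_colors_mem], a colour absent
   from x0 M occurs only on x0 R, so the cosets of M in R suffice. *)
pose F (B : {set gT}) := square_colors (x0 * repr B) :\: square_colors x0.
have cover_colors : c @: G \subset
    square_colors x0 :|: \bigcup_(B in rcosets M R :\ M%g) F B.
  apply/subsetP=> _ /imsetP[z Gz ->].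
  have [cz|ncz] := boolP (c z \in square_colors x0); first by rewrite inE cz.
  pose r := x0^-1 * z; have zE : z = x0 * r by rewrite mulKVg.
  have Gr : r \in G by rewrite groupM ?groupV.
  have Rr : r \in R by apply: contraNT ncz => nr; rewrite zE square_colors_mem.
  rewrite inE (negPf ncz); apply/bigcupP; exists (M :* r).
    rewrite !inE; apply/andP; split; last by apply/rcosetsP; exists r.
    apply: contraNneq ncz => /esym defB.
    have: r \in M by rewrite defB rcoset_refl.
    by rewrite defM zE => /imsetP[g Gg ->]; rewrite imset_f.
  (* The representative of M r is g^2 r, so z = x0 r is reached from it by the square of g^-1. *)
  rewrite inE ncz /=; have /rcosetP[m Mm ->] := mem_repr_rcoset 'Mho^1(G) r.
  have : m \in M := Mm; rewrite defM => /imsetP[g Gg ->].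
  have Gg2 : g ^+ 2 \in G by rewrite groupX.
  apply/imsetP; exists g^-1; rewrite ?groupV //.
  rewrite expgVn zE; move: (g ^+ 2) Gg2 => u Gu.
  by rewrite (cG Gu Gr) (mulgA x0 r u) mulgK.
have GB B : B \in rcosets M R -> repr B \in R.
  case/rcosetsP=> r Rr ->; have /rcosetP[m Mm ->] := mem_repr_rcoset 'Mho^1(G) r.
  by rewrite (groupM (G := square_stab_group x0)) // (subsetP (sMR x0)).
have Gy B : B \in rcosets M R -> x0 * repr B \in G.
  by move=> /GB/(subsetP sRG) Gr; rewrite groupM.
have card_rc : #|rcosets M R :\ M%g| = b.-1.
  rewrite [b](cardsD1 (M : {set gT})) -/M.
  have -> //: (M : {set gT}) \in rcosets M R.
  by apply/rcosetsP; exists 1; rewrite ?group1 // mulg1.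
have sF B : F B \subset square_colors (x0 * repr B) by apply: subsetDl.
apply: leq_trans (subset_leq_card cover_colors) _.
apply: leq_trans (leq_card_setU _ _).1 _.
apply: leq_trans (leq_add (leA x0 Gx0) (leqnn _)) _.
(* For a = 1 no colour can be saved, but none need be: each of the b - 1 further cosets adds at most
   one colour. *)
have [a1|a1] := leqP a 1.
  have {}a1 : a = 1%N by apply/eqP; rewrite eqn_leq a1.
  rewrite ab a1 mul1n -(prednK b0) add1n ltnS -card_rc -[leqRHS]muln1.
  apply: card_bigcup_leq => B /setD1P[_ RB]; rewrite -a1.
  exact: leq_trans (subset_leq_card (sF B)) (leA _ (Gy _ RB)).
have FB B : B \in rcosets M R -> #|F B| <= a.-1.
  move=> RB; have Gb := subsetP sRG _ (GB _ RB); have Gyb := Gy B RB.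
  (* If all of G stabilises, this coset has a single colour, and 1 <= a - 1. *)
  have [GR|nGR] := boolP (G \subset square_stab (x0 * repr B)).
    apply: leq_trans (subset_leq_card (sF B)) _.
    apply: leq_trans (square_colors_leq _) _.
    by move: GR; rewrite -indexg_eq1 => /eqP->; rewrite -ltnS prednK.
  have nGR0 : ~~ (G \subset R) by rewrite -indexg_eq1 neq_ltn a1 orbT.
  (* Since [repr B] is in R and w is not, [repr B * w] is outside R: the point x0 (repr B) w takes
     its colour from both cosets, so one colour is not new. *)
  have [w [Gw nRw nRyw]] := exists_notin_subgroups nGR0 nGR.
  have cw := square_colors_mem Gyb Gw nRyw.
  have cw0 : c (x0 * repr B * w) \in square_colors x0.
    rewrite -mulgA; apply: square_colors_mem => //; first exact: groupM.
    by rewrite groupMl ?(GB B RB).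
  have := leA _ Gyb; rewrite (cardsD1 (c (x0 * repr B * w))) cw add1n => leA1.
  rewrite -ltnS prednK //; apply: leq_trans leA1; rewrite ltnS subset_leq_card //.
  apply/subsetP=> i /setDP[iy i0]; rewrite !inE iy andbT.
  by apply: contraNneq i0 => ->.
rewrite ab -(prednK b0) mulnS leq_add2l.
apply: (@leq_trans (b.-1 * a.-1)); last by rewrite mulnC leq_mul ?leq_pred.
rewrite -card_rc; apply: card_bigcup_leq => B /setD1P[_ RB]; exact: FB.
Qed.

End ExponentFour.

(** * The bound for all abelian 2-groups, by induction *)

Lemma abelian_2group_colors (gT : finGroupType) (C : finType) (c : gT -> C)
    (G : {group gT}) :
  abelian G -> 2.-group G -> rainbow_free c G -> #|c @: G| <= #|'Ohm_1(G)|.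
Proof.
(* The group type varies too, since the hypothesis is applied to a quotient. *)
have [n] := ubnP #|G|; elim: n => // n IHn in gT c G *.
rewrite ltnS => leGn cGG pG rf.
have [/forall_inP exp4|] := boolP [forall x in G, x ^+ 4 == 1].
  by apply: exponent4_colors => // x /exp4/eqP.
rewrite negb_forall => /existsP[x]; rewrite negb_imply => /andP[Gx x4].
have cO : abelian 'Ohm_2(G) := abelianS (Ohm_sub 2 G) cGG.
have defO : 'Ohm_2(G) = 'Ldiv_4(G) := OhmEabelian pG cO.
have [eO|[K maxK sOK]] := maximal_exists (Ohm_sub 2 G).
  move: Gx; rewrite -eO /= defO.
  by case/LdivP=> _ /eqP; rewrite (negPf x4).
have iK := p_maximal_index pG maxK; have sKG : K \subset G := proper_sub (maxgroupp maxK).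
have exclusive (X Y : {set gT}) : X :|: Y = G -> #|c @: X| <= #|'Ohm_1(G)| ->
    #|'Ohm_1(G)| < #|c @: G| -> exists2 q, q \in Y & c q \notin c @: X.
  move=> defG leX gtG.
  have /subsetPn[_ /imsetP[q Gq ->] nXq] : ~~ (c @: G \subset c @: X).
    by apply: contraL gtG => /subset_leq_card le; rewrite -leqNgt (leq_trans le).
  exists q => //; move: Gq; rewrite -defG => /setUP[Xq|//].
  by rewrite imset_f in nXq.
have ltKG : #|K| < #|G|.
  by rewrite -(Lagrange sKG) iK muln2 -addnn -[ltnLHS]addn0 ltn_add2l cardG_gt0.
have leO : #|'Ohm_1(K)| <= #|'Ohm_1(G)| by rewrite subset_leq_card ?OhmS.
have [cKK pK] := (abelianS sKG cGG, pgroupS sKG pG).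
have IHK (c' : gT -> C) : rainbow_free c' K -> #|c' @: K| <= #|'Ohm_1(G)|.
  by move=> rf'; rewrite (leq_trans _ leO) // IHn // (leq_trans ltKG).
rewrite leqNgt; apply/negP => gtG.
have [g gGK] : exists g, g \in G :\: K.
  apply/set0Pn; rewrite -card_gt0 cardsD (setIidPr sKG) subn_gt0 //.
have [Gg nKg] := setDP gGK.
have defK' := rcoset_index2 sKG iK gGK.
have leK : #|c @: K| <= #|'Ohm_1(G)|.
  by apply: IHK => y z Ky Kz; apply: rf; apply: (subsetP sKG).
have leK' : #|c @: (G :\: K)| <= #|'Ohm_1(G)|.
  (* Translation by g turns the colouring of K g into one of K. *)
  rewrite -defK' -rcosetE /rcoset -imset_comp; apply: IHK => y z Ky Kz /=.
  have [Gy Gz] := (subsetP sKG y Ky, subsetP sKG z Kz).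
  have := rf _ _ (groupM Gy Gg) (groupM Gz Gg).
  by rewrite /refl invMg !mulgA mulgK.
have KK' : K :|: (G :\: K) = G by rewrite -{2}(setID G K) (setIidPr sKG).
have K'K : (G :\: K) :|: K = G by rewrite setUC.
have [q K'q cq] := exclusive _ _ KK' leK gtG.
have [p Kp cp] := exclusive _ _ K'K leK' gtG.
have [Gq nKq] := setDP K'q; have Gp := subsetP sKG p Kp.
have sK'G : G :\: K \subset G := subsetDl _ _.
have K'K_refl : {in G :\: K & K, forall y z, refl y z \in K}.
  by move=> y z; apply: index2_refl_mem.
have KK'_refl : {in K & G :\: K, forall y z, refl y z \in G :\: K}.
  move=> y z Ky /setDP[Gz nKz]; have Gy := subsetP sKG y Ky.
  by rewrite inE /refl groupMr // groupMl // groupV nKz /= !groupM ?groupV.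
pose e := (p * q^-1) ^+ 4; have Ge : e \in G by rewrite groupX ?groupM ?groupV.
have eV : e^-1 = (q * p^-1) ^+ 4 by rewrite -expgVn invMg invgK.
have Ke : e \in K.
  by rewrite /e (expgM _ 2 2) groupX ?(index2_sqr_mem sKG iK) ?groupM ?groupV.
have invK : {in K, forall y, c (e * y) = c y}.
  by move=> y; apply: (exclusive_invariant cGG rf sKG sK'G).
(* Exchanging the roles of p and q inverts the translation. *)
have invK' : {in G :\: K, forall y, c (e^-1 * y) = c y}.
  by move=> y; rewrite eV; apply: (exclusive_invariant cGG rf sK'G sKG).
have inve y : y \in G -> c (e * y) = c y.
  rewrite -KK' => /setUP[|/setDP[Gy nKy]]; first exact: invK.
  by rewrite -(invK' (e * y)) ?mulKg // inE groupMl // nKy groupM.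
(* Here K must contain 'Ohm_2(G): if (p/q)^4 = 1, then p/q, and with it q, would lie in K. *)
have e1 : e != 1.
  apply: contra nKq => /eqP e1; rewrite -groupV -(groupMl _ Kp).
  by rewrite (subsetP sOK) //= defO; apply/LdivP; rewrite groupM ?groupV.
clearbody e.
have sDG : <[e]> \subset G by rewrite cycle_subG.
have invD : {in <[e]> & G, forall d y, c (d * y) = c y}.
  move=> _ y /cycleP[k ->] Gy; elim: k => [|k IHk]; first by rewrite mul1g.
  by rewrite expgS -mulgA inve ?groupM ?groupX.
have ltQ : #|G / <[e]>| < n.
  by rewrite (leq_trans _ leGn) // ltn_quotient ?cycle_eq1.
have := IHn _ _ (G / <[e]>)%G ltQ (quotient_abelian _ cGG) (quotient_pgroup _ pG)
  (rainbow_free_quotient cGG sDG invD rf).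
rewrite (imset_quotient_color cGG sDG invD) => leQ.
by move: gtG; rewrite ltnNge (leq_trans leQ) // card_Ohm1_quotient_leq.
Qed.

Local Open Scope ring_scope.
Import GRing.Theory.

(** * Upper and lower bounds for [aw H 3] *)

Section AntiVanDerWaerden3.
Variable H : finZmodType.

Lemma rainbow_ap3E r (c : {ffun H -> 'I_r}) (a d : H) :
  rainbow_ap c 3 a d =
  [&& c a != c (a + d), c (a + d) != c (a + d *+ 2) & c a != c (a + d *+ 2)].
Proof.
apply/forallP/and3P => [rb|[n01 n12 n02] i].
  have rbP (i j : 'I_3) : (i < j)%N -> c (ap a d i) != c (ap a d j).
    by move=> ij; have /forallP/(_ j)/implyP/(_ ij) := rb i.
  have := rbP (inord 0) (inord 1); have := rbP (inord 1) (inord 2).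
  have := rbP (inord 0) (inord 2); rewrite /ap !inordK // mulr0n mulr1n addr0.
  by move=> /(_ isT) ? /(_ isT) ? /(_ isT) ?.
apply/forallP=> j; apply/implyP; rewrite /ap.
by case: i j => [[|[|[|?]]] ?] [[|[|[|?]]] ?] //= _; rewrite ?mulr0n ?mulr1n ?addr0.
Qed.

Lemma no_rainbow_ap3_rainbow_free r (c : {ffun H -> 'I_r}) :
  ~~ has_rainbow_ap c 3 -> rainbow_free (c : H -> 'I_r) [set: H].
Proof.
move=> nrb x z _ _; move: nrb; rewrite negb_exists => /forallP/(_ x).
rewrite negb_exists => /forallP/(_ (z - x)).
have rE : refl (z : H) x = x + (z - x) *+ 2.
  by rewrite mulr2n addrA [x + _]addrC subrK addrC.
rewrite rainbow_ap3E -rE [x + _]addrC subrK !negb_and !negbK.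
by case/or3P=> /eqP; [apply: Or31 | apply: Or32 | apply: Or33].
Qed.

Lemma aw3_leq :
  (2.-group [set: H])%g -> (aw H 3 <= #|'Ohm_1([set: H])%g|.+1)%N.
Proof.
move=> pH; rewrite /aw; case: ex_minnP => r _; apply; rewrite /forces_rainbow_ap /=.
apply/forallP=> c; apply/implyP=> /forallP ex; apply: contraT.
move=> /no_rainbow_ap3_rainbow_free/(abelian_2group_colors (FinRing.zmod_abelian _) pH).
have ->: (c : H -> _) @: [set: H] = [set: 'I_(#|'Ohm_1([set: H])%g|.+1)].
  apply/setP=> i; rewrite inE; have /existsP[h /eqP <-] := ex i; exact: imset_f.
by rewrite cardsT card_ord ltnn.
Qed.

Lemma aw3_gt (V : finType) (f : H -> V) :
  (forall v, exists h, f h = v) -> (forall a d, f (a + d *+ 2) = f a) ->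
  (#|V| < aw H 3)%N.
Proof.
move=> f_surj f2; rewrite /aw; case: ex_minnP => -[//|r] /andP[_ /forallP fr] _.
rewrite ltnS leqNgt; apply/negP => ltrV.
(* With r + 1 <= |V| colours available, [inord] sends the ranks above r to colour 0; all r + 1
   colours still occur. *)
pose c : {ffun H -> 'I_r.+1} := [ffun h => inord (enum_rank (f h))].
have exc : exact_coloring c.
  apply/forallP=> i; have [h fh] := f_surj (enum_val (Ordinal (leq_trans (ltn_ord i) ltrV))).
  by apply/existsP; exists h; rewrite ffunE fh enum_valK inord_val.
have /implyP/(_ exc)/existsP[a /existsP[d]] := fr c.
by rewrite rainbow_ap3E !ffunE f2 eqxx !andbF.
Qed.

End AntiVanDerWaerden3.

(** * Parity and 2-torsion in cyclic groups *)

Lemma exp2_gt1 n : (0 < n)%N -> (1 < 2 ^ n)%N.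
Proof. by move=> n0; rewrite -{1}(expn0 2) ltn_exp2l. Qed.

Lemma odd_Zp_add n (x y : 'Z_(2 ^ n)) : (0 < n)%N ->
  odd (x + y)%R = odd x (+) odd y.
Proof.
move=> n0; have p2 := Zp_cast (exp2_gt1 n0).
by rewrite /= odd_mod ?oddD // p2 oddX orbF; case: n n0 {x y p2}.
Qed.

Lemma Zp_2torsion_inj n (x y : 'Z_n) :
  x *+ 2 = 0 -> y *+ 2 = 0 -> (x == 0) = (y == 0) -> x = y.
Proof.
(* A nonzero z < N with N dividing 2z has 2z = N, where N is the order of ['Z_n]. *)
have half (z : 'Z_n) : z *+ 2 = 0 -> z != 0 -> (z + z = (Zp_trunc n).+2)%N.
  move=> /(congr1 val)/eqP; rewrite -(inj_eq val_inj) /= -/(dvdn _ _).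
  case: z => k /= ltk /dvdnP[q eq] k0; rewrite eq; move: eq.
  by case: q => [|[|q]]; lia.
move=> x2 y2; have [-> /esym/eqP -> //|x0 /esym/negbT y0] := eqVneq x 0.
by apply/val_inj => /=; have := half x x2 x0; have := half y y2 y0; lia.
Qed.

Lemma Zp_mulrn_self n (x : 'Z_n) : (1 < n)%N -> x *+ n = 0.
Proof. by move=> n1; rewrite -mulr_natr pchar_Zp ?mulr0. Qed.

(** * Products of cyclic 2-groups *)

Section PowersOfTwo.
Variables (s : nat) (m : 'I_s -> nat).
Hypothesis m_gt0 : forall i : 'I_s, (0 < m i)%N.

Let H : finZmodType := zmod_prod (fun i : 'I_s => 'Z_(2 ^ m i) : finZmodType).

Lemma zmod_prodD (x y : H) i : (x + y) i = x i + y i.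
Proof. by rewrite ffunE. Qed.

Lemma zmod_prodMn (x : H) k i : (x *+ k) i = x i *+ k.
Proof.
elim: k => [|k IHk]; first by rewrite !mulr0n ffunE.
by rewrite !mulrS zmod_prodD IHk.
Qed.

(** The quotient map H -> H/2H, written as s bits: the extremal colouring. *)
Definition parity (x : H) : {ffun 'I_s -> bool} := [ffun i => odd (x i)].

Lemma parity_double a d : parity (a + d *+ 2) = parity a.
Proof.
apply/ffunP=> i; rewrite [LHS]ffunE [RHS]ffunE zmod_prodD zmod_prodMn mulr2n !odd_Zp_add //.
by rewrite addbb addbF.
Qed.

Lemma parity_surj (v : {ffun 'I_s -> bool}) : exists h, parity h = v.
Proof.
exists ([ffun i : 'I_s => (v i)%:R : 'Z_(2 ^ m i)] : H).
apply/ffunP=> i; rewrite !ffunE val_Zp_nat ?exp2_gt1 // modn_small ?oddb //.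
by rewrite (leq_ltn_trans (leq_b1 _)) ?exp2_gt1.
Qed.

Lemma zmod_prod_2group : (2.-group [set: H])%g.
Proof.
rewrite -pnat_exponent.
apply: (@pnat_dvd _ (2 ^ \sum_i m i)%N); last by rewrite pnatX.
apply/exponentP=> x _; rewrite FinRing.zmodXgE.
apply/ffunP=> i; rewrite zmod_prodMn ffunE.
by rewrite (bigD1 i) //= expnD mulrnA Zp_mulrn_self ?exp2_gt1 ?mul0rn.
Qed.

(** Each cyclic factor has at most one nonzero element killed by 2, so an element of H killed by 2
    is determined by which components vanish. *)
Lemma card_Ohm1_zmod_prod : (#|'Ohm_1([set: H])%g| <= 2 ^ s)%N.
Proof.
rewrite (OhmEabelian zmod_prod_2group) ?FinRing.zmod_abelian //.
pose f (x : H) : {ffun 'I_s -> bool} := [ffun i => x i == 0].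
have <-: #|{ffun 'I_s -> bool}| = (2 ^ s)%N by rewrite card_ffun card_bool card_ord.
rewrite -(@card_in_imset _ _ f) ?max_card // => x y.
move=> /LdivP[_ x2] /LdivP[_ y2] /ffunP fxy; apply/ffunP=> i.
have {}x2 : x *+ 2 = 0 := x2; have {}y2 : y *+ 2 = 0 := y2.
apply: Zp_2torsion_inj; last by have := fxy i; rewrite !ffunE.
  by rewrite -zmod_prodMn x2 ffunE.
by rewrite -zmod_prodMn y2 ffunE.
Qed.

End PowersOfTwo.

Theorem theorem12 (s : nat) (hs : (0 < s)%N)
    (m : 'I_s -> nat) (hm : forall i : 'I_s, (0 < m i)%N) :
  aw (zmod_prod (fun i : 'I_s => 'Z_(2 ^ m i) : finZmodType)) 3 = (2 ^ s + 1)%N.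
Proof.
apply/eqP; rewrite eqn_leq addn1; apply/andP; split.
  by rewrite (leq_trans (aw3_leq (zmod_prod_2group hm))) // ltnS card_Ohm1_zmod_prod.
have := aw3_gt (parity_surj hm) (parity_double hm).
by rewrite card_ffun card_bool card_ord.
Qed.
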